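(* Let $f:X\to Y$ be a Darboux injection between manifolds. If $\dim(Y)\le 3$, then $\dim(X)\le\dim(Y)$.
   Context: Maps are not assumed continuous. A map $f:X\to Y$ between topological spaces is Darboux if for every connected subspace $C\subset X$ the image $f(C)$ is connected. A Darboux injection is an injective Darboux map. For $n\in\mathbb{N}$, a metrizable space $X$ is an $n$-manifold if every point $x\in X$ has an open neighborhood homeomorphic to an open subset of the half-space $\mathbb{R}^n_+=\{(x_1,\dots,x_n)\in\mathbb{R}^n: x_1\ge 0\}$ (so boundary is allowed). A manifold is a space that is an $n$-manifold for some $n\in\mathbb{N}$, and $\dim$ denotes this $n$. Manifolds are not assumed connected or compact. *)

(* Defs.v *)
From HB Require Import structures.
From mathcomp Require Import all_boot all_order all_algebra.
From mathcomp Require Import all_classical all_reals all_analysis.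
Set Implicit Arguments.
Unset Strict Implicit.
Unset Printing Implicit Defensive.
Import Order.TTheory GRing.Theory Num.Theory.
Import numFieldNormedType.Exports.
Local Open Scope classical_set_scope.
Local Open Scope ring_scope.

Definition metrizable (R : realType) (X : topologicalType) : Prop :=
  exists d : X -> X -> R,
    [/\ forall x y, d x y = 0 <-> x = y,
        forall x y, d x y = d y x,
        forall x y z, d x z <= d x y + d y z
      & forall (x : X) (A : set X),
          nbhs x A <-> exists2 e : R, 0 < e & [set y | d x y < e] `<=` A].

Definition homeomorphic (S T : topologicalType) : Prop :=
  exists (f : S -> T) (g : T -> S),
    [/\ cancel f g, cancel g f, continuous f & continuous g].

(* Coordinates are numbered from 0, so the first one has index 0.  For n = 0
   there is no coordinate and the constraint is void: half_space R 0 is a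
   point, and the 0-manifolds are the discrete spaces. *)
Definition half_space (R : realType) (n : nat) : set 'rV[R]_n :=
  [set x | forall i : 'I_n, val i = 0%N -> 0 <= x ord0 i].
Arguments half_space : clear implicits.

(* Subsets coerce to the subtypes [set_type], which carry the subspace
   topology: V is open in half_space R n, not necessarily in 'rV[R]_n. *)
Definition manifold (R : realType) (n : nat) (X : topologicalType) : Prop :=
  metrizable R X /\
  forall x : X, exists U : set X, exists V : set (half_space R n),
    [/\ open U, U x, open V & homeomorphic U V].

Definition darboux (X Y : topologicalType) (f : X -> Y) : Prop :=
  forall C : set X, connected C -> connected (f @` C).

(* Main.v *)
Require Import Defs.
From mathcomp Require Import all_boot all_order all_algebra all_fingroup.
From mathcomp Require Import all_classical all_reals all_analysis.
From mathcomp Require Import lra zify.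
Import Order.TTheory GRing.Theory Num.Theory.
Import numFieldNormedType.Exports.
Set Implicit Arguments.
Unset Strict Implicit.
Unset Printing Implicit Defensive.
Local Open Scope classical_set_scope.
Local Open Scope ring_scope.

(** The argument is a dimension count in Alexander-Spanier cohomology modulo 2.

Let [m] be the dimension of [Y] and suppose that [X] has dimension at least
[m + 1].  Then [X] contains a cube of dimension [m + 1] ([cube_embeds]), and
restricting [f] gives a Darboux injection [g] of that cube into [Y].  The cube
carries a nonzero class of degree [m + 1] relative to its boundary
([cube_class_nontrivial]).

The degree is now lowered one unit at a time.  Suppose that a compact set [K]
carries a nonzero relative class of positive degree.  Passing to an
intersection, take [K] minimal with this property ([minimal_carrier]).  A point
carries no class of positive degree, so [K] has two points, and a suitable
closed set [S] of [Y] separates their images.  As [g] is Darboux,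
[K \ g^-1 S] is disconnected: otherwise its image would be a connected set
missing [S] and meeting both sides.  Hence [K] is the union of two proper closed
subsets [A1] and [A2] with intersection in [g^-1 S].  The class vanishes on each
of them by minimality, so by Mayer-Vietoris it comes from a nonzero class of one
degree less on [A1 `&` A2] ([darboux_carrier]).  The two pieces of the
disconnected set [K \ g^-1 S] need not be the preimages of the two sides of [S]; this is why
minimality, and not a bisection, is used.

The separators are chosen so that dimension drops as well.  The first one is the
boundary of a small box in a chart of [Y], and each later one is a coordinate
hyperplane [{y | y_i = r}] with a new value of [r].  After [j] steps the image of
the carrier consists of points at least [j] of whose coordinates are confined to
finite sets ([no_carrier_in_chart]).  After [m + 1] steps the degree is [0] but
the carrier is empty, since there are only [m] coordinates: a contradiction. *)

(** * Cochains modulo 2 on sequences of points *)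

Section Cochains.
Variable T : eqType.
Implicit Types (c d : seq T -> bool) (s t : seq T) (r : T -> T).

(** Cochains modulo 2 are boolean functions on sequences of points, added with
[(+)]; a sequence of length [k + 1] is a [k]-simplex.  Leaving the degree out of
the type allows a cochain to be restricted by prefixing a vertex, which makes
every identity below an induction on the sequence. *)
Fixpoint coboundary c s : bool :=
  if s is x :: t then c t (+) coboundary (fun u => c (x :: u)) t else false.

(** The sum of the values of [c] on the simplices
[x_0 .. x_i, r x_i .. r x_n] that triangulate the prism between [s] and its image
under [r]. *)
Fixpoint prism r c s : bool :=
  if s is x :: t
  then c (x :: r x :: map r t) (+) prism r (fun u => c (x :: u)) t
  else false.

Lemma coboundary_local c d s :
    (forall t, {subset t <= s} -> (size t).+1 = size s -> c t = d t) ->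
  coboundary c s = coboundary d s.
Proof.
elim: s c d => [//|x s IH] c d cd /=; congr (_ (+) _).
  by apply: cd => // y ys; rewrite inE ys orbT.
apply: IH => t ts [tE]; apply: cd => [y|]; last by rewrite /= tE.
by rewrite !inE => /orP[->//|/ts ->]; rewrite orbT.
Qed.

Lemma coboundaryD c d s :
  coboundary (fun u => c u (+) d u) s = coboundary c s (+) coboundary d s.
Proof. by elim: s c d => [//|x s IH] c d /=; rewrite IH addbACA. Qed.

Lemma coboundary0 s : coboundary (fun=> false) s = false.
Proof. by elim: s. Qed.

Lemma coboundaryK c s : coboundary (coboundary c) s = false.
Proof.
by elim: s c => [//|x s IH] c /=; rewrite coboundaryD IH addbF addbb.
Qed.

Lemma coboundary_map r c s :
  coboundary (fun u => c (map r u)) s = coboundary c (map r s).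
Proof.
by elim: s c => [//|x s IH] c /=; rewrite (IH (fun u => c (r x :: u))).
Qed.

Lemma prism_local r c s :
    (forall t, {subset t <= s ++ map r s} -> size t = (size s).+1 ->
      c t = false) ->
  prism r c s = false.
Proof.
elim: s c => [//|x s IH] c c0 /=; rewrite c0 /= ?size_map//; last first.
  move=> y; rewrite !(inE, mem_cat) => /or3P[->//|->|->];
  by rewrite !orbT.
apply: IH => t ts tE; apply: c0; last by rewrite /= tE.
move=> y; rewrite !inE => /orP[->//|/ts]; rewrite !mem_cat inE.
by case/orP=> ->; rewrite !orbT.
Qed.

Lemma prismD r c d s :
  prism r (fun u => c u (+) d u) s = prism r c s (+) prism r d s.
Proof. by elim: s c d => [//|x s IH] c d /=; rewrite IH addbACA. Qed.

(** Displacing all vertices by an arbitrary map [r] does not change the class of a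
cocycle.  No continuity of [r] is involved, which is what makes discontinuous
retractions available later. *)
Lemma prism_homotopy r c s :
  coboundary (prism r c) s = c s (+) c (map r s) (+) prism r (coboundary c) s.
Proof.
elim: s c => [|x s IH] c /=; first by rewrite addbb.
rewrite coboundaryD prismD IH (coboundary_map r (fun u => c (x :: r x :: u))).
move: (prism r c s) (coboundary _ _) (c (x :: s)) (c (x :: map r s)).
by move: (c _) (prism _ _ _); do 6!case.
Qed.

Lemma coboundary_nseq c n x :
  coboundary c (nseq n x) = odd n && c (nseq n.-1 x).
Proof.
elim: n c => [//|n IH] c /=; rewrite IH.
case: n {IH} => [|n] /=; first by rewrite addbF.
by case: (odd n) => /=; rewrite ?addbb ?addbF.
Qed.

Lemma coboundaryZ b c s :
  coboundary (fun u => b && c u) s = b && coboundary c s.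
Proof. by case: b => //=; rewrite coboundary0. Qed.

Lemma coboundary_iota c (f : nat -> T) m n :
  coboundary c (map f (iota m n.+1)) =
  \big[addb/false]_(i < n.+1) c (map f (iota m i ++ iota (m + i).+1 (n - i))).
Proof.
elim: n m c => [|n IH] m c; first by rewrite big_ord1 /= addbF.
rewrite big_ord_recl subn0 addn0.
transitivity (c (map f (iota m.+1 n.+1)) (+)
  coboundary (fun u => c (f m :: u)) (map f (iota m.+1 n.+1))); first by [].
rewrite IH; congr (_ (+) _); apply: eq_bigr => i _.
by rewrite /= addSnnS subSS.
Qed.

(** The cup product of the coboundaries of the [0]-cochains in [hs]. *)
Fixpoint cup (hs : seq (T -> bool)) s : bool :=
  match hs, s with
  | [::], _ => true
  | h :: hs', x :: ((y :: _) as t) => (h x (+) h y) && cup hs' t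
  | _, _ => false
  end.

(** The product is itself the coboundary of the cochain [q] in which the first
factor is left undifferentiated, by the Leibniz rule. *)
Lemma coboundary_cup hs s :
  size s = (size hs).+2 -> coboundary (cup hs) s = false.
Proof.
elim: hs s => [[|x [|y []]]//|h hs IH] s sz.
pose q u := if u is x :: _ then h x && cup hs u else false.
rewrite (@coboundary_local _ (coboundary q)) ?coboundaryK// => t _.
rewrite sz /= => -[]; case: t => [|x [|y t]]// tk.
have := IH [:: x, y & t] tk.
rewrite [coboundary q _]/= coboundaryZ [LHS]/=.
move: (coboundary _ _) (cup hs (y :: t)) (cup hs (x :: t)) (h x) (h y).
by do 5!case.
Qed.

Lemma cup_iota (h : nat -> T -> bool) (f : nat -> T) m n :
  cup (map h (iota m n)) (map f (iota m n.+1)) =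
  all (fun i => h i (f i) (+) h i (f i.+1)) (iota m n).
Proof. by elim: n m => [//|n IH] m /=; rewrite -IH. Qed.

(** A factor that is constant on the simplex has zero coboundary there. *)
Lemma cup_eq0 (I : eqType) (h : I -> T -> bool) (r : seq I) i s :
    i \in r -> {in s &, forall x y, h i x = h i y} ->
  size s = (size r).+1 -> cup (map h r) s = false.
Proof.
elim: r s => [//|j r IH] [|x [|y s]]//; rewrite inE => /orP[/eqP->|ir] hi [sz].
  by rewrite /= (hi x y) ?addbb// !inE eqxx ?orbT.
rewrite [LHS]/=; apply/negbTE; rewrite negb_and; apply/orP; right.
apply/negbT; apply: IH => //; last by rewrite /= sz.
by move=> a b as_ bs; apply: hi; rewrite inE ?as_ ?bs orbT.
Qed.

End Cochains.

(** * Relative Alexander-Spanier cohomology of subsets of a metric space *)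

Section RelativeCohomology.
Variables (R : realType) (T : pseudoMetricType R).
Implicit Types (K L A : set T) (e : R) (s t : seq T) (v w : seq T -> bool).

Definition small e s := forall x y, x \in s -> y \in s -> ball x e y.

Definition inside K s := forall x, x \in s -> K x.

Definition thicken K L e := [set x | K x /\ exists2 y, L y & ball x e y].

Lemma small_le e1 e2 s : e1 <= e2 -> small e1 s -> small e2 s.
Proof. by move=> e12 sm x y xs ys; apply: (le_ball e12); exact: sm. Qed.

Lemma small_sub e s t : {subset t <= s} -> small e s -> small e t.
Proof. by move=> ts sm x y /ts xs /ts ys; exact: sm. Qed.

Lemma inside_sub K s t : {subset t <= s} -> inside K s -> inside K t.
Proof. by move=> ts sm x /ts; exact: sm. Qed.

Lemma inside_le K L s : K `<=` L -> inside K s -> inside L s.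
Proof. by move=> KL Ks x /Ks; exact: KL. Qed.

Lemma thicken_le K L e1 e2 : e1 <= e2 -> thicken K L e1 `<=` thicken K L e2.
Proof.
by move=> e12 x [Kx [y Ly xy]]; split=> //; exists y => //; exact: le_ball xy.
Qed.

Lemma subset_thicken K L e : 0 < e -> L `<=` K -> L `<=` thicken K L e.
Proof. by move=> e0 LK x Lx; split; [exact: LK|exists x => //; exact: ballxx]. Qed.

(** A quantitative form of compactness: a point that is close to both [L] and [A] is
close to [L `&` A]. *)
Lemma ball_closed_compact L A e : compact L -> closed A -> 0 < e ->
  exists2 d, 0 < d &
    forall x y, A x -> L y -> ball x d y -> exists2 z, (L `&` A) z & ball x e z.
Proof.
move=> cL cA e0; have e20 : 0 < e / 2 by rewrite divr_gt0.
pose P d y := forall x, A x -> ball x d y -> exists2 z, (L `&` A) z & ball x e z.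
have : \forall d \near 0^'+, L `<=` P d.
  apply: ((compact_near_coveringP L).1 cL) => y Ly.
  have [Ay|nAy] := pselect (A y).
    exists (ball y (e / 2), [set d | d < e / 2]) => /=.
      by split; [exact: nbhsx_ballx|exact: nbhs_right_lt].
    move=> [y' d] /= [yy' de] x Ax xy'; exists y => //.
    rewrite (splitr e); apply: (@ball_triangle _ _ y').
      by apply: le_ball xy'; exact: ltW.
    exact: ball_sym.
  have /nbhs_ballP[r /= r0 rA] : nbhs y (~` A).
    by apply: open_nbhs_nbhs; split => //; exact: closed_openC.
  have r20 : 0 < r / 2 by rewrite divr_gt0.
  exists (ball y (r / 2), [set d | d < r / 2]) => /=.
    by split; [exact: nbhsx_ballx|exact: nbhs_right_lt].
  move=> [y' d] /= [yy' de] x Ax xy'; exfalso; apply: (rA x) => //.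
  rewrite (splitr r); apply: (@ball_triangle _ _ y') => //.
  by apply: ball_sym; apply: le_ball xy'; exact: ltW.
move=> LP; have [d [LPd d0]] := filter_ex (filterI LP (nbhs_right_gt (0 : R))).
by exists d => // x y Ax Ly; exact: LPd.
Qed.

Variable B : set T.
Hypothesis B_closed : closed B.

(** Alexander-Spanier cochains are germs at the diagonal, so that identities are
required only on simplices of diameter below some scale [e].  The first clause
makes the cocycle relative: it vanishes on [K `&` B]. *)
Definition cocycle k K w := exists2 e, 0 < e &
  (forall s, size s = k.+1 -> small e s -> inside (K `&` B) s -> w s = false) /\
  (forall s, size s = k.+2 -> small e s -> inside K s ->
     coboundary w s = false).

(** Triviality of the class of [w] in the cohomology of [K] relative to [K `&` B].
In degree [k] the primitive [v] is evaluated on sequences of length [k]; for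
[k = 0] the relative clause forces [v [::] = false]. *)
Definition cobounds k K w := exists2 e, 0 < e & exists v,
  (forall s, size s = k -> small e s -> inside (K `&` B) s -> v s = false) /\
  (forall s, size s = k.+1 -> small e s -> inside K s -> coboundary v s = w s).

Lemma cocycle_le k K L w : K `<=` L -> cocycle k L w -> cocycle k K w.
Proof.
move=> KL [e e0 [w1 w2]]; exists e => //; split=> s sk se sK.
  by apply: w1 => //; apply: inside_le sK => x [/KL].
by apply: w2 => //; apply: inside_le sK.
Qed.

Lemma cobounds_le k K L w : K `<=` L -> cobounds k L w -> cobounds k K w.
Proof.
move=> KL [e e0 [v [w1 w2]]]; exists e => //; exists v; split=> s sk se sK.
  by apply: w1 => //; apply: inside_le sK => x [/KL].
by apply: w2 => //; apply: inside_le sK.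
Qed.

Lemma cobounds0 k w : cobounds k set0 w.
Proof.
exists 1 => //; exists (fun=> false); split => // -[//|x s] _ _ /(_ x).
by rewrite inE eqxx => /(_ erefl).
Qed.

(** The map sends a point near [L] to a nearby point of [L], chosen in [B] when the
given point lies in [B]; [ball_closed_compact] provides the latter choice.  It is
discontinuous in general, but it moves every point by less than [e]. *)
Lemma retraction L e : compact L -> 0 < e ->
  exists2 d, 0 < d & exists r : T -> T,
    [/\ forall x, ball x e (r x),
        forall x y, L y -> ball x d y -> L (r x) &
        forall x y, L y -> ball x d y -> B x -> B (r x)].
Proof.
move=> cL e0; have [d d0 dP] := ball_closed_compact cL B_closed e0.
exists (Num.min d e); first by rewrite lt_min d0.
have rP x : exists z, ball x e z /\
    ((exists2 y, L y & ball x (Num.min d e) y) -> L z /\ (B x -> B z)).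
  have [[y Ly xy]|nL] := pselect (exists2 y, L y & ball x (Num.min d e) y);
    last by exists x; split; [exact: ballxx|].
  have [Bx|nBx] := pselect (B x).
    have [|z [Lz Bz] xz] := dP x y Bx Ly; last by exists z.
    by apply: le_ball xy; rewrite ge_min lexx.
  by exists y; split => //; apply: le_ball xy; rewrite ge_min lexx orbT.
exists (fun x => projT1 (cid (rP x))).
by split=> x; case: cid => z /= [xz zP] => // y Ly xy;
  have [] := zP (ex_intro2 _ _ y Ly xy).
Qed.

Lemma small_map (r : T -> T) e s : 0 < e -> (forall x, ball x e (r x)) ->
  small e s -> small (e + e + e) (s ++ map r s).
Proof.
move=> e0 re sm.
have re' x : x \in s ++ map r s -> exists2 y, y \in s & ball x e y.
  rewrite mem_cat => /orP[xs|/mapP[y ys ->]].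
    by exists x => //; exact: ballxx.
  by exists y => //; apply: ball_sym; exact: re.
move=> x y /re'[x' x's xx'] /re'[y' y's yy'].
apply: (@ball_triangle _ _ y'); last exact: ball_sym.
by apply: (@ball_triangle _ _ x') => //; exact: sm.
Qed.

(** Tautness: triviality on a compact set extends to a neighbourhood.  Pull the
primitive back along a retraction that moves points little, and correct it by the
prism operator. *)
Lemma cobounds_thicken k K L w : compact L -> L `<=` K ->
  cocycle k K w -> cobounds k L w ->
  exists2 d, 0 < d & cobounds k (thicken K L d) w.
Proof.
move=> cL LK [e1 e10 [w1 w2]] [e2 e20 [v [v1 v2]]].
(* A simplex of diameter [e] together with its displaced copy has diameter at
   most [3 e]. *)
have [e [e0 ee1 ee2]] :
    exists e, [/\ 0 < e, e + e + e <= e1 & e + e + e <= e2].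
  exists (Num.min e1 e2 / 3).
  have : 0 < Num.min e1 e2 by rewrite lt_min e10.
  have : Num.min e1 e2 <= e1 by rewrite ge_min lexx.
  have : Num.min e1 e2 <= e2 by rewrite ge_min lexx orbT.
  by move: (Num.min _ _) => m *; split; lra.
have [d d0 [r [re rL rB]]] := retraction cL e0.
exists d => //; exists e => //.
exists (fun s => v (map r s) (+) prism r w s).
have rsub s : {subset map r s <= s ++ map r s}.
  by move=> x; rewrite mem_cat => ->; rewrite orbT.
have rin s : inside (thicken K L d) s -> inside L (map r s).
  by move=> sM _ /mapP[x /sM[_ [y Ly xy]] ->]; exact: rL xy.
have rinB s : inside (thicken K L d `&` B) s -> inside B (map r s).
  by move=> sM _ /mapP[x /sM[[_ [y Ly xy]] Bx] ->]; exact: rB xy _.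
have rK s : inside (thicken K L d) s -> inside K (s ++ map r s).
  move=> sM x; rewrite mem_cat => /orP[/sM[]//|].
  by move/(rin _ sM); exact: LK.
split=> s sk se sM.
  have sm := small_map e0 re se.
  have sM' : inside (thicken K L d) s by apply: inside_le sM => x [].
  rewrite v1 ?size_map//=.
  - apply: prism_local => t ts tk; apply: w1; first by rewrite tk sk.
      by apply: small_le ee1 _; exact: small_sub sm.
    move=> x /ts xs; split; first exact: rK xs.
    by move: xs; rewrite mem_cat => /orP[/sM[]//|]; exact: rinB.
  - by apply: small_le ee2 _; exact: small_sub sm.
  - by move=> x xs; split; [exact: (rin s)|exact: (rinB s)].
have sm := small_map e0 re se.
rewrite coboundaryD prism_homotopy coboundary_map v2 ?size_map//.
- rewrite (@prism_local _ _ (coboundary w)) ?addbF.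
    by rewrite addbC addbK.
  move=> t ts tk; apply: w2; first by rewrite tk sk.
    by apply: small_le ee1 _; exact: small_sub sm.
  by move=> x /ts; exact: rK.
- by apply: small_le ee2 _; exact: small_sub sm.
- exact: rin.
Qed.

(** Cohomology of a point in positive degree.  All simplices are constant, so that
the cone [s |-> w (x :: s)] is a primitive in even degree [k.+1]; in odd degree
the cocycle condition on a constant simplex already gives [w = 0]. *)
Lemma cobounds_sub1 k K w x : K `<=` [set x] -> cocycle k.+1 K w ->
  cobounds k.+1 K w.
Proof.
move=> Kx [e e0 [w1 w2]]; exists e => //.
have constK s : inside K s -> s = nseq (size s) x.
  by move=> sK; apply/all_pred1P/allP => y /sK /Kx /eqP.
exists (fun s => w (x :: s)); split=> s sk se sK.
  have sKx : inside (K `&` B) (x :: s).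
    move=> y; rewrite inE => /orP[/eqP ->|/sK//].
    move: sk sK; case: s {se} => [//|z s] _ /(_ z); rewrite inE eqxx.
    by move=> /(_ erefl) KBz; have <- : z = x by exact: Kx KBz.1.
  apply: w1; rewrite /= ?sk// => y z; rewrite !inE.
  have xE u : u \in s -> u = x by move/sK => [/Kx].
  move=> yP zP; have -> : y = x by case/orP: yP => [/eqP//|/xE].
  have -> : z = x by case/orP: zP => [/eqP//|/xE].
  exact: ballxx.
rewrite (constK s sK) sk coboundary_nseq /=.
rewrite negbK; case: (boolP (odd k)) => [//|ek] /=.
have nE y : y \in nseq k.+3 x -> y = x by case/nseqP.
have Kx' : K x.
  move: sK sk; case: s {se} => [//|z s] /(_ z).
  by rewrite inE eqxx => /(_ erefl) Kz _; rewrite -(Kx _ Kz).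
have <- : coboundary w (nseq k.+3 x) = w (nseq k.+2 x).
  by rewrite coboundary_nseq /= negbK ek.
symmetry; apply: w2; rewrite ?size_nseq// => y; last by move=> /nE ->.
by move=> z /nE -> /nE ->; exact: ballxx.
Qed.

End RelativeCohomology.

(** * The Mayer-Vietoris sequence and minimal carriers *)

Section MayerVietoris.
Variables (R : realType) (T : pseudoMetricType R) (B : set T).
Hypothesis B_closed : closed B.
Implicit Types (K L A : set T) (e : R) (s t : seq T) (v w : seq T -> bool).

Lemma thickenI K A1 A2 e : compact A1 -> closed A2 -> 0 < e ->
  exists2 d, 0 < d &
    thicken K A1 d `&` thicken K A2 d `<=` thicken K (A1 `&` A2) e.
Proof.
move=> cA1 cA2 e0; have e20 : 0 < e / 2 by rewrite divr_gt0.
have [d d0 dP] := ball_closed_compact cA1 cA2 e20.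
exists (Num.min (d / 2) (e / 2)); first by rewrite lt_min divr_gt0.
move=> x [[Kx [a A1a xa]] [_ [b A2b xb]]]; split=> //.
have [|z Az bz] := dP b a A2b A1a.
  rewrite (splitr d); apply: (@ball_triangle _ _ x).
    by apply/ball_sym; apply: le_ball xb; rewrite ge_min lexx.
  by apply: le_ball xa; rewrite ge_min lexx.
exists z => //; rewrite (splitr e); apply: (@ball_triangle _ _ b) => //.
by apply: le_ball xb; rewrite ge_min lexx orbT.
Qed.

Lemma inside_thicken K A d s x : small d s -> inside K s -> x \in s -> A x ->
  inside (thicken K A d) s.
Proof.
move=> sd sK xs Ax y ys; split; first exact: sK.
by exists x => //; exact: sd.
Qed.

(** Exactness of the Mayer-Vietoris sequence: the difference [u] of two primitives
of [w], over [A1] and over [A2], is a cocycle on the intersection, and a primitive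
of [u] would allow the two to be glued.  A small simplex of [A1 `|` A2] may have
vertices in both [A1 `\` A2] and [A2 `\` A1]; for this reason everything is first
extended to neighbourhoods by [cobounds_thicken], after which every small simplex
lies in one of two thickened pieces. *)
Lemma mayer_vietoris k A1 A2 w : compact A1 -> compact A2 ->
    closed A1 -> closed A2 -> cocycle B k.+1 (A1 `|` A2) w ->
    cobounds B k.+1 A1 w -> cobounds B k.+1 A2 w ->
    ~ cobounds B k.+1 (A1 `|` A2) w ->
  exists2 u, cocycle B k (A1 `&` A2) u & ~ cobounds B k (A1 `&` A2) u.
Proof.
set K := A1 `|` A2 => cA1 cA2 A1cl A2cl wK wA1 wA2 wNK.
have A1K : A1 `<=` K by move=> x; left.
have A2K : A2 `<=` K by move=> x; right.
have [d1 d10 [e1 e10 [v1 [v1B v1w]]]] := cobounds_thicken B_closed cA1 A1K wK wA1.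
have [d2 d20 [e2 e20 [v2 [v2B v2w]]]] := cobounds_thicken B_closed cA2 A2K wK wA2.
pose M := thicken K A1 d1 `&` thicken K A2 d2.
pose u s := v1 s (+) v2 s.
have uM : cocycle B k M u.
  exists (Num.min e1 e2); first by rewrite lt_min e10.
  split=> s sk se sM.
    rewrite /u v1B ?v2B//.
    - by apply: small_le se; rewrite ge_min lexx orbT.
    - by apply: inside_le sM => x [[]].
    - by apply: small_le se; rewrite ge_min lexx.
    - by apply: inside_le sM => x [[]].
  rewrite /u coboundaryD v1w ?v2w ?addbb//.
  - by apply: small_le se; rewrite ge_min lexx orbT.
  - by apply: inside_le sM => x [].
  - by apply: small_le se; rewrite ge_min lexx.
  - by apply: inside_le sM => x [].
have LM : A1 `&` A2 `<=` M.
  move=> x [A1x A2x].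
  by split; apply: subset_thicken => //.
exists u; first exact: cocycle_le uM.
move=> uL; apply: wNK.
have cL : compact (A1 `&` A2) by exact: compact_closedI.
have [d3 d30 [e3 e30 [z [zB zu]]]] := cobounds_thicken B_closed cL LM uM uL.
have [d4 d40 d4P] := thickenI K cA1 A2cl d30.
have [e [e0 ee1 ee2 ee3 [ed1 ed2 ed4]]] : exists e, [/\ 0 < e, e <= e1, e <= e2,
    e <= e3 & [/\ e <= d1, e <= d2 & e <= d4]].
  exists (Num.min e1 (Num.min e2 (Num.min e3 (Num.min d1 (Num.min d2 d4))))).
  by rewrite !lt_min !ge_min !lexx !orbT e10 e20 e30 d10 d20 d40.
pose M1 := thicken K A1 e; pose M2 := thicken K A2 e.
have M1d : M1 `<=` thicken K A1 d1 by exact: thicken_le.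
have M2d : M2 `<=` thicken K A2 d2 by exact: thicken_le.
have M12 : M1 `&` M2 `<=` thicken M (A1 `&` A2) d3.
  move=> x [M1x M2x]; split; first by split; [exact: M1d|exact: M2d].
  by have [|_ //] := d4P x; split; [move: M1x|move: M2x]; exact: thicken_le.
(* [z'] is the primitive of [u] extended by zero; adding its coboundary to [v2]
   makes it agree with [v1] on the overlap. *)
pose z' s := `[< inside (M1 `&` M2) s >] && z s.
pose v s := if `[< inside M1 s >] then v1 s else v2 s (+) coboundary z' s.
have cover s : small e s -> inside K s -> inside M1 s \/ inside A2 s.
  move=> se sK; have [[x [xs A1x]]|nA1] := pselect (exists x, x \in s /\ A1 x).
    by left; exact: inside_thicken xs A1x.
  right=> x xs; have [A1x|//] := sK x xs.
  by exfalso; apply: nA1; exists x.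
have A2M2 : A2 `<=` M2 by exact: subset_thicken.
exists e => //; exists v; split=> s sk se sK; rewrite /v.
  have sK' : inside K s by apply: inside_le sK => x [].
  have sB : inside B s by move=> x /sK[].
  case: asboolP => [s1|ns1].
    apply: v1B; rewrite ?sk//; first exact: small_le se.
    by move=> x xs; split; [exact/M1d/s1|exact: sB].
  have [//|s2] := cover s se sK'.
  rewrite v2B ?sk//=.
  - rewrite (@coboundary_local _ _ (fun=> false)) ?coboundary0// => t ts tk.
    rewrite /z'; case: asboolP => //= tM; apply: zB.
    + by move: tk; rewrite sk => -[].
    + by apply: small_sub ts _; exact: small_le se.
    + by move=> x xt; split; [exact/M12/tM|exact/sB/ts].
  - exact: small_le se.
  - by move=> x xs; split; [exact/M2d/A2M2/s2|exact: sB].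
case: (pselect (inside M1 s)) => [s1|ns1].
  rewrite -(v1w s)//; last 2 first.
  - exact: small_le se.
  - by apply: inside_le s1.
  apply: coboundary_local => t ts tk.
  by rewrite asboolT//; exact: inside_sub s1.
have [//|s2] := cover s se sK.
have sM2 : inside M2 s by apply: inside_le s2.
transitivity (coboundary (fun t => v2 t (+) coboundary z' t) s); last first.
  rewrite coboundaryD coboundaryK addbF v2w//; first exact: small_le se.
  by apply: inside_le sM2.
apply: coboundary_local => t ts tk; case: asboolP => //= t1.
have tM : inside (M1 `&` M2) t by move=> x xt; split; [exact: t1|exact/sM2/ts].
rewrite (@coboundary_local _ _ z) ?zu.
- by rewrite /u addbC addbK.
- by move: tk; rewrite sk => -[].
- by apply: small_sub ts _; exact: small_le se.
- by move=> x /tM; exact: M12.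
- move=> t' t't _; rewrite /z' asboolT//.
  exact: inside_sub tM.
Qed.

(** Zorn's lemma applies because, by tautness, a class that vanishes on the
intersection of a chain of compact sets vanishes on a member of the chain. *)
Lemma minimal_carrier k K w : compact K -> closed K ->
    cocycle B k K w -> ~ cobounds B k K w ->
  exists K0, [/\ K0 `<=` K, closed K0, ~ cobounds B k K0 w &
    forall K', closed K' -> K' `<=` K0 -> ~ K0 `<=` K' -> cobounds B k K' w].
Proof.
move=> cK Kcl wK wNK.
pose P (C : set T) := open C /\ ~ cobounds B k (K `\` C) w.
have [F FP totF|C [[Co CN] Cmax]] := @Zorn_bigcup _ P; last first.
  exists (K `\` C); split => //.
  - by apply: closedI => //; exact: open_closedC.
  move=> K' K'cl K'K0 nK0; apply: contrapT => nK'.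
  apply: (Cmax (~` K')).
    rewrite properEneq; split; last by move=> x Cx /K'K0[].
    apply/eqP => CK'; apply: nK0 => x [Kx].
    by rewrite CK' => /contrapT.
  split; first exact: closed_openC.
  suff -> : K `\` ~` K' = K' by [].
  rewrite setDE setCK; apply/setIidPr => x /K'K0[] //.
split; first by apply: bigcup_open => X /FP[].
set Kinf := K `\` _ => wKinf.
have [F0|nF0] := pselect (F !=set0); last first.
  apply: wNK; suff <- : Kinf = K by [].
  rewrite /Kinf setDE; apply/setIidPl => x _ [X FX _].
  by apply: nF0; exists X.
have Kinf_closed : closed Kinf.
  apply: closedI => //; apply: open_closedC.
  by apply: bigcup_open => X /FP[].
have cKinf : compact Kinf.
  by apply: subclosed_compact Kinf_closed cK _; exact: subDsetl.
have [d d0 wd] := cobounds_thicken B_closed cKinf (@subDsetl _ _ _) wK wKinf.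
(* The chain [F] of removed open sets is directed, so its tails form a filter;
   compactness of [K] along this filter shows that one [K `\` X] lies in the
   neighbourhood of [Kinf] on which the class vanishes. *)
pose G : set_system (set T) :=
  fun S => exists2 X, F X & forall X', F X' -> X `<=` X' -> S X'.
have GF : Filter G.
  split.
  - by case: F0 => X FX; exists X.
  - move=> S1 S2 [X1 FX1 S1X] [X2 FX2 S2X].
    have [X12|X21] := totF X1 X2 FX1 FX2.
      exists X2 => // X' FX' X2X'; split; last exact: S2X.
      by apply: S1X => //; exact: subset_trans X2X'.
    exists X1 => // X' FX' X1X'; split; first exact: S1X.
    by apply: S2X => //; exact: subset_trans X1X'.
  - by move=> S1 S2 S12 [X FX SX]; exists X => // X' FX' XX'; exact/S12/SX.
pose Q X x := K x -> thicken K Kinf d x \/ X x.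
have [x Kx|X FX XQ] := (compact_near_coveringP K).1 cK _ G Q GF.
  have [[X FX Xx]|nFx] := pselect ((\bigcup_(X in F) X) x).
    exists (X, [set X' | F X' /\ X `<=` X']) => /=.
      split; last by exists X.
      by apply: open_nbhs_nbhs; split => //; have [] := FP X FX.
    by move=> [x' X'] /= [Xx' [FX' XX']] Kx'; right; exact: XX'.
  exists (ball x d, setT) => /=.
    by split; [exact: nbhsx_ballx|exact: filterT].
  move=> [x' X'] /= [xx' _] Kx'; left; split => //.
  by exists x; [split|exact: ball_sym].
have [_] := FP X FX; apply; apply: cobounds_le wd => x [Kx nXx].
by have [] := XQ X FX (@subset_refl _ X) x Kx Kx.
Qed.

End MayerVietoris.

(** * The fundamental class of the cube *)

Section Cube.
Variables (R : realType) (n : nat).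
Local Notation E := 'rV[R]_n.+1.

Definition cube : set E := [set x | forall i, `[0, 1]%classic (x ord0 i)].

Definition cube_boundary : set E :=
  [set x | exists i, x ord0 i = 0 \/ x ord0 i = 1].

Lemma compact_cube : compact cube.
Proof. exact: (@rV_compact R _ (fun=> `[0, 1]%classic) (fun=> @segment_compact _ _ _)). Qed.

Lemma closed_coord (A : set R) i : closed A -> closed [set x : E | A (x ord0 i)].
Proof.
move=> Acl; apply: (@preimage_closed _ _ (fun x : E => x ord0 i)) => // x _.
exact: coord_continuous.
Qed.

Lemma closed_cube : closed cube.
Proof.
have -> : cube = \bigcap_(i in setT) [set x : E | `[0, 1]%classic (x ord0 i)].
  by apply/seteqP; split=> [x xc i _|x xc i]; exact: xc.
by apply: closed_bigI => i _; apply: closed_coord; exact: interval_closed.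
Qed.

Lemma closed_cube_boundary : closed cube_boundary.
Proof.
have -> : cube_boundary = \bigcup_(i in [set: 'I_n.+1])
    [set x : E | ([set 0] `|` [set 1 : R]) (x ord0 i)].
  by apply/seteqP; split=> [x [i xi]|x [i _ xi]]; exists i.
apply: closed_bigcup => [|i _]; [exact: finite_finset|apply: closed_coord].
by apply: closedU; exact: closed_eq.
Qed.

Definition beyond_half i (x : E) : bool := 1 / 2 < x ord0 (inord i).

(** The cup product of the generators of the cohomology of the interval relative to
its end points, one for each coordinate: the generator is the coboundary of the
indicator function of the upper half. *)
Definition cube_class : seq E -> bool := cup (map beyond_half (iota 0 n.+1)).

(** Near a face [x_i = 0] or [x_i = 1] the [i]-th indicator function is constant, so
the [i]-th factor vanishes on small simplices of the boundary. *)
Lemma cocycle_cube_class : cocycle cube_boundary n.+1 cube cube_class.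
Proof.
exists (1 / 2); first lra.
split=> s sk se sK; last first.
  by apply: coboundary_cup; rewrite size_map size_iota.
case: s sk se sK => [//|x s] sk se sK.
have [] := sK x; first by rewrite inE eqxx.
move=> _ [i xi]; apply: (@cup_eq0 _ _ _ _ (val i)); last first.
- by rewrite sk size_iota.
- have close y : y \in x :: s -> `|x ord0 i - y ord0 i| < 1 / 2.
    by move=> ys; have [_ ] := se x y (mem_head _ _) ys; apply.
  have unit_itv y : y \in x :: s -> 0 <= y ord0 i <= 1.
    by move=> ys; have [/(_ i)] := sK y ys; rewrite /= in_itv.
  have half y : y \in x :: s -> beyond_half i y = beyond_half i x.
    move=> ys; rewrite /beyond_half inord_val.
    move: (close y ys) (unit_itv y ys); rewrite ltr_norml.
    by case: xi => ->; case: ltrP; case: ltrP => //; lra.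
  by move=> y z ys zs /=; rewrite !half.
- by rewrite mem_iota /=.
Qed.

Section Triangulation.
Variable t : nat.
Local Notation M := t.*2.+1.
Local Notation simplex := ({ffun 'I_n.+1 -> 'I_M} * {perm 'I_n.+1})%type.
Implicit Types p : simplex.

(** The Freudenthal triangulation of the cube subdivided into [M^(n+1)] small cubes.
A simplex is a small cube [p.1] and an order [p.2] in which the coordinates are
increased one after the other, coordinate [l] at step [p.2 l]; [level p j] is the
integral position of its [j]-th vertex.  The number [M] is odd in order that no
vertex has a coordinate equal to [1 / 2]. *)
Definition level p j l : nat := (p.1 l + (p.2 l < j))%N.

Definition vertex p j : E := \row_l ((level p j l)%:R / M%:R).

Lemma level_le p j l : (level p j l <= M)%N.
Proof.
rewrite /level; have := ltn_ord (p.1 l).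
by case: (_ < j)%N; rewrite ?addn1 ?addn0 //; exact: ltnW.
Qed.

Lemma vertex_cube p j : cube (vertex p j).
Proof.
move=> l; rewrite /= in_itv /= mxE divr_ge0//= ler_pdivrMr ?ltr0n//.
by rewrite mul1r ler_nat level_le.
Qed.

Lemma vertex_small e p s : M%:R^-1 < e -> small e (map (vertex p) s).
Proof.
move=> Me x y /mapP[j _ ->] /mapP[k _ ->]; split.
  by apply: lt_trans Me; rewrite invr_gt0 ltr0n.
move=> i l; rewrite !mxE /ball /= -mulrBl normrM.
rewrite (ger0_norm (_ : 0 <= M%:R^-1)) ?invr_ge0//.
apply: le_lt_trans Me; rewrite ler_piMl ?invr_ge0//.
rewrite /level !natrD opprD addrACA subrr add0r.
by case: (_ < j)%N; case: (_ < k)%N;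
  rewrite ?subr0 ?sub0r ?subrr ?normrN ?normr0 ?normr1.
Qed.

Lemma beyond_half_vertex p j (i : 'I_n.+1) :
  beyond_half i (vertex p j) = (t < level p j i)%N.
Proof.
rewrite /beyond_half inord_val mxE ltr_pdivlMr ?ltr0n//.
rewrite mul1r mulrC ltr_pdivrMr// -natrM ltr_nat; lia.
Qed.

(** Only the simplex of the central small cube that increases the coordinates in
their natural order crosses each hyperplane [x_i = 1 / 2] at step [i]. *)
Lemma sum_cube_class :
  \big[addb/false]_p cube_class (map (vertex p) (iota 0 n.+2)) = true.
Proof.
have tM : (t < M)%N by lia.
pose p0 : simplex := ([ffun=> Ordinal tM], 1%g).
rewrite (bigD1 p0)//= big1 ?addbF => [|p pp0].
  rewrite /cube_class cup_iota; apply/allP => i; rewrite mem_iota /= => iN.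
  rewrite -[i]/(val (Ordinal iN)) !beyond_half_vertex /level /= !ffunE perm1 /=.
  by rewrite ltnn addn0 ltnn ltnSn addn1 ltnSn.
apply/negbTE; apply: contra pp0; rewrite /cube_class cup_iota => /allP pP.
have pE l : p.1 l = Ordinal tM /\ p.2 l = l.
  have := pP (val l); rewrite mem_iota /= ltn_ord => /(_ isT).
  rewrite !beyond_half_vertex /level.
  case: (ltngtP (p.2 l) l) => [pl|pl|pl]; last first.
  - rewrite pl ltnSn addn0 addn1 => H; split; last exact: val_inj.
    apply: val_inj => /=; move: H.
    by case: (ltnP t (p.1 l)) => ?; case: (ltnP t (p.1 l).+1) => //= ? _; lia.
  - have -> : (p.2 l < l.+1)%N = false by lia.
    by rewrite addbb.
  - have -> : (p.2 l < l.+1)%N = true by lia.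
    by rewrite addbb.
apply/eqP; case: p {pP} pE => a r /= pE; congr (_, _).
  by apply/ffunP => l; rewrite ffunE; have [] := pE l.
by apply/permP => l; rewrite perm1; have [] := pE l.
Qed.

Definition face p i := map (vertex p) (iota 0 i ++ iota i.+1 (n.+1 - i)).

Lemma coboundary_faces c p :
  coboundary c (map (vertex p) (iota 0 n.+2)) =
  \big[addb/false]_(i < n.+2) c (face p i).
Proof. exact: coboundary_iota. Qed.

(** The vertex reached at an inner step [i.+1] is forgotten, so that exchanging the
coordinates increased at the steps [i] and [i.+1] gives another simplex with the
same face.  The exchange flips the parity of the order, hence it pairs off all
simplices. *)
Lemma inner_faces_cancel (c : seq E -> bool) i : (0 < i <= n)%N ->
  \big[addb/false]_p c (face p i) = false.
Proof.
case: i => [//|i] /= iN.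
pose x : 'I_n.+1 := inord i; pose y : 'I_n.+1 := inord i.+1.
have xE : x = i :> nat by rewrite inordK// ltnW.
have yE : y = i.+1 :> nat by rewrite inordK.
have xy : x != y by rewrite -val_eqE /= xE yE neq_ltn ltnSn.
pose swap p : simplex := (p.1, (p.2 * tperm x y)%g).
have swap_inj : injective swap.
  by move=> [a r] [a' r'] [-> /mulIg ->].
have swapE p j : j != i.+1 -> vertex (swap p) j = vertex p j.
  move=> ji; apply/rowP => l; rewrite !mxE /level /= permM.
  case: tpermP => [->|->|//]; rewrite xE yE;
  by congr ((_ + nat_of_bool _)%:R / _); lia.
rewrite (bigID (fun p => odd_perm p.2)) /= (reindex_inj swap_inj) /=.
have addb_eq (a b : bool) : a = b -> a (+) b = false by move=> ->; rewrite addbb.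
apply: addb_eq; apply: eq_big => p /=; first by rewrite odd_permM odd_tperm xy addbT.
move=> _; congr c; apply/eq_in_map => j; rewrite mem_cat !mem_iota => ji.
by apply: swapE; apply/eqP => jE; move: ji; rewrite jE; lia.
Qed.

(** Let [l0] be the coordinate increased first.  The face opposite to the first
vertex is the face opposite to the last vertex of the simplex in the next small
cube in direction [l0], with [l0] increased last.  Taking the next cube
cyclically makes this a bijection on all simplices; where it wraps around, both
faces lie in the boundary of the cube. *)
Lemma outer_faces_cancel (c : seq E -> bool) :
    (forall p i, (i <= n.+1)%N -> inside cube_boundary (face p i) ->
      c (face p i) = false) ->
  \big[addb/false]_p c (face p 0) = \big[addb/false]_p c (face p n.+1).
Proof.
move=> c0.
pose rot : {perm 'I_n.+1} := perm (can_inj (@ord_predK n.+1)).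
pose next p : simplex :=
  ([ffun l => if p.2 l == ord0 then ordS (p.1 l) else p.1 l], (p.2 * rot)%g).
have next_inj : injective next.
  move=> [a r] [a' r'] [aE /mulIg rE]; rewrite -{}rE in aE *; congr (_, _).
  apply/ffunP => l; move/ffunP/(_ l): aE; rewrite !ffunE /=.
  by case: eqP => // _ /(can_inj (@ordSK _)).
rewrite [RHS](reindex_inj next_inj); apply: eq_bigr => p _.
pose l0 := (p.2^-1)%g ord0.
have l0E : p.2 l0 = ord0 by rewrite permKV.
have rotE l : rot l = (if l == ord0 then n else l.-1) :> nat.
  rewrite permE /=; case: eqP => [->|/eqP l_neq0].
    by rewrite add0n modn_small.
  have l_gt0 : (0 < l)%N by rewrite lt0n.
  have -> : (l + n.+1).-1 = (l.-1 + n.+1)%N by lia.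
  by rewrite modnDr modn_small//; have := ltn_ord l; lia.
have [al0|al0] := eqVneq (p.1 l0) ord_max.
  rewrite !c0// => _ /mapP[j jP ->]; exists l0; rewrite mxE /level.
    left; rewrite /= ffunE permM l0E eqxx rotE /= al0 modnn add0n.
    move: jP; rewrite mem_cat !mem_iota => jP.
    have -> : (n < j)%N = false by lia.
    by rewrite mul0r.
  right; rewrite l0E al0 /=.
  move: jP; rewrite mem_iota => jP; have -> : (0 < j)%N by lia.
  by rewrite addn1 divff// pnatr_eq0.
congr c; rewrite /face subn0 subnn cats0 cat0s.
have -> : iota 1 n.+1 = map succn (iota 0 n.+1) by exact: (iotaDl 1 0).
rewrite -map_comp.
apply/eq_in_map => j; rewrite mem_iota add0n => /= jn.
apply/rowP => l; rewrite !mxE /level /= ffunE permM rotE; congr (_%:R / _).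
case: eqP => [pl|/eqP pl].
  have -> : l = l0 by rewrite /l0 -pl permK.
  have al0' : (p.1 l0 < t.*2)%N.
    by have := ltn_ord (p.1 l0); move: al0; rewrite -val_eqE /=; lia.
  by rewrite /= modn_small// l0E /=; lia.
by move: pl; rewrite -val_eqE /=; case: (nat_of_ord (p.2 l)).
Qed.

End Triangulation.

(** The sum of a coboundary over all simplices of a fine triangulation is zero,
because faces inside the cube are shared by two simplices and the primitive
vanishes on faces in the boundary; the sum of the class is not. *)
Lemma cube_class_nontrivial :
  ~ cobounds cube_boundary n.+1 cube cube_class.
Proof.
case=> e e0 [v [vB vw]].
have [t te] : exists t, t.*2.+1%:R^-1 < e.
  have [t _ /(_ t) te] := near_infty_natSinv_lt (PosNum e0).
  exists t; apply: le_lt_trans (te (leqnn _)).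
  by rewrite lef_pV2 ?posrE ?ltr0n// ler_nat; lia.
have := sum_cube_class t.
under eq_bigr => p _.
  rewrite -vw; last first.
  - by move=> _ /mapP[j _ ->]; exact: vertex_cube.
  - exact: vertex_small.
  - by rewrite size_map size_iota.
  rewrite coboundary_faces.
  over.
rewrite exchange_big (bigD1 ord0)//= (bigD1 ord_max)//= [X in _ (+) (_ (+) X)]big1.
  rewrite addbF outer_faces_cancel ?addbb// => p j jn pB; apply: vB.
  - by rewrite size_map size_cat !size_iota subnKC.
  - exact: vertex_small.
  - by move=> x xf; split; [case/mapP: xf => k _ ->; exact: vertex_cube|exact: pB].
move=> j j_neq; apply: inner_faces_cancel.
by move: j_neq (ltn_ord j); rewrite -!val_eqE /=; lia.
Qed.

End Cube.

(** * Darboux maps lower the degree of a class *)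

Section Separation.
Variables (R : realType) (T : pseudoMetricType R).

(** Take around each point of [P] and of [Q] a ball that misses the other set even
when its radius is doubled. *)
Lemma separated_open (P Q : set T) : separated P Q ->
  exists U V, [/\ open U, open V, P `<=` U, Q `<=` V & U `&` V = set0].
Proof.
pose fat (P Q : set T) := \bigcup_(z in [set z : T * R | P z.1 /\ 0 < z.2 /\
  forall q, Q q -> ~ ball z.1 (z.2 + z.2) q]) (ball z.1 z.2)°.
have fat_open P' Q' : open (fat P' Q').
  by apply: bigcup_open => z _; exact: open_interior.
have fat_sub P' Q' : P' `&` closure Q' = set0 -> P' `<=` fat P' Q'.
  move=> PQ x Px; have : ~ closure Q' x by move=> Qx; rewrite -[False]/(set0 x) -PQ.
  move=> /existsNP[S /not_implyP[/nbhs_ballP[r /= r0 rS] QS]].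
  exists (x, r / 2) => /=.
    split=> //; split; first by rewrite divr_gt0.
    by move=> q Qq; rewrite -splitr => xq; apply: QS; exists q; split => //; exact: rS.
  by apply: nbhs_singleton; apply: nbhs_interior; apply: nbhsx_ballx; rewrite divr_gt0.
case=> PQ QP; exists (fat P Q), (fat Q P); split => //.
- exact: fat_sub.
- by apply: fat_sub; rewrite setIC.
rewrite -subset0 => x [[[p r] /= [Pp [r0 pQ]] /interior_subset px]].
case=> [[q s] /= [Qq [s0 qP]] /interior_subset qx].
case: (leP r s) => rs.
  apply: (qP p) => //; apply: (@ball_triangle _ _ x) => //.
  by apply: ball_sym; apply: le_ball px.
apply: (pQ q) => //; apply: (@ball_triangle _ _ x) => //.
by apply: ball_sym; apply: le_ball qx; exact: ltW.
Qed.

Variable B : set T.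
Hypothesis B_closed : closed B.

(** The inductive step.  If removing a set disconnects a minimal carrier, then the
carrier is the union of two proper closed subsets that meet in that set, and
Mayer-Vietoris finds a carrier of one degree less inside the removed set.  The
preimage of the complement of [O1 `|` O2] is such a set because [g] is Darboux. *)
Lemma darboux_carrier (Y : topologicalType) (g : T -> Y) k K w (O1 O2 : set Y) :
    compact K -> closed K -> cocycle B k.+1 K w -> ~ cobounds B k.+1 K w ->
    (forall K', closed K' -> K' `<=` K -> ~ K `<=` K' -> cobounds B k.+1 K' w) ->
    (forall C, C `<=` K -> connected C -> connected (g @` C)) ->
    open O1 -> open O2 -> O1 `&` O2 = set0 ->
    (exists2 x, K x & O1 (g x)) -> (exists2 x, K x & O2 (g x)) ->
  exists L u, [/\ closed L, L `<=` K `&` g @^-1` (~` (O1 `|` O2)),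
    cocycle B k L u & ~ cobounds B k L u].
Proof.
move=> cK Kcl wK wNK wmin gD O1o O2o O12 [x1 Kx1 O1x1] [x2 Kx2 O2x2].
pose C := K `&` g @^-1` (O1 `|` O2).
have : ~ connected C.
  move=> /(gD C (@subIsetl _ _ _)) Cc.
  have gCE : g @` C `&` O1 = g @` C.
    apply: Cc.
    - by exists (g x1); split => //; exists x1 => //; split => //; left.
    - by exists O1.
    - exists (~` O2); first exact: open_closedC.
      apply/seteqP; split=> y [gCy Oy]; split => //.
        by move=> O2y; rewrite -[False]/(set0 y) -O12.
      by case: gCy => x [_ []] + xy; rewrite xy.
  have : (g @` C) (g x2) by exists x2 => //; split => //; right.
  by rewrite -gCE => -[_ O1x2]; rewrite -[False]/(set0 (g x2)) -O12.
case/connectedPn => E [E0 CE /separated_open[U [V [Uo Vo PU QV UV]]]].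
pose A1 := K `\` U; pose A2 := K `\` V.
have A1cl : closed A1 by apply: closedI => //; exact: open_closedC.
have A2cl : closed A2 by apply: closedI => //; exact: open_closedC.
have A12 : A1 `|` A2 = K.
  apply/seteqP; split=> [x [[]|[]]//|x Kx].
  have [Ux|nUx] := pselect (U x); last by left.
  by right; split => // Vx; rewrite -[False]/(set0 x) -UV.
have cA1 : compact A1 by apply: subclosed_compact A1cl cK _; exact: subDsetl.
have cA2 : compact A2 by apply: subclosed_compact A2cl cK _; exact: subDsetl.
have [p Pp] := E0 false; have [q Qq] := E0 true.
have EK b : E b `<=` K.
  move=> x Ex; suff [] : C x by [].
  by rewrite CE; case: b Ex; [right|left].
have [||||u uL uNL] := @mayer_vietoris _ _ _ B_closed k _ _ w cA1 cA2 A1cl A2cl.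
- by rewrite A12.
- apply: wmin => //; first exact: subDsetl.
  by move=> /(_ p (EK _ _ Pp))[_]; apply; exact: PU.
- apply: wmin => //; first exact: subDsetl.
  by move=> /(_ q (EK _ _ Qq))[_]; apply; exact: QV.
- by rewrite A12.
exists (A1 `&` A2), u; split => //; first exact: closedI.
move=> x [[Kx nUx] [_ nVx]]; split => // Ox.
have : C x by [].
by rewrite CE => -[/PU|/QV].
Qed.

End Separation.

(** * Charts and separating boxes in a manifold *)

Section Charts.
Variable (R : realType).

Lemma nbhs_set_type (X : topologicalType) (A : set X) (x : A) (S : set A) :
  nbhs x S <-> exists2 W, nbhs (val x) W & forall y : A, W (val y) -> S y.
Proof.
split.
  case=> _ [] [W Wo <-] /= Wx WS; exists W; first exact: open_nbhs_nbhs.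
  by move=> y; exact: WS.
case=> W Wx WS; move: Wx; rewrite {1}nbhsE /= => -[W' W'x W'W].
have [W'o W'x'] := W'x.
exists (set_val @^-1` W'); split => //; first by exists W'.
by move=> y /W'W; exact: WS.
Qed.

(** Charts as functions [c] and [d] between [X] and the ambient vector space, total but
meaningful on [U] and on [V `&` half_space R n] only; this avoids the nested
subtypes of the definition of a manifold. *)
Lemma manifold_chart n (X : topologicalType) (x : X) : manifold R n X ->
  exists (U : set X) (V : set 'rV[R]_n) (c : X -> 'rV[R]_n) (d : 'rV[R]_n -> X),
  [/\ open U, U x,
      forall y, U y -> [/\ (V `&` half_space R n) (c y), d (c y) = y &
        {for y, continuous c}],
      open V &
      forall z, (V `&` half_space R n) z ->
        [/\ U (d z), c (d z) = z &
          d @ within (V `&` half_space R n) (nbhs z) --> d z]].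
Proof.
case=> _ /(_ x)[U [V [Uo Ux [V' V'o V'V] [f [g [fK gK fc gc]]]]]].
have VV' z : V z -> V' (val z) by rewrite -V'V.
pose c y := if pselect (U y) is left h
  then val (val (f (exist _ y (mem_set h)))) else 0.
have cE (y : U) : c (val y) = val (val (f y)).
  rewrite /c; case: pselect => [h|[]]; last exact: set_valP.
  by congr (val (val (f _))); exact: val_inj.
have WP z : (V' `&` half_space R n) z -> exists y : V, val (val y) = z.
  move=> [V'z Hz]; have Vz : V (exist _ z (mem_set Hz)).
    by rewrite -V'V.
  by exists (exist _ (exist _ z (mem_set Hz)) (mem_set Vz)).
pose d z := if pselect (exists y : V, val (val y) = z) is left h
  then val (g (projT1 (cid h))) else x.
have dE (y : V) : d (val (val y)) = val (g y).
  rewrite /d; case: pselect => [h|[]]; last by exists y.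
  by case: cid => y' /= /val_inj/val_inj ->.
have VW (y : V) : (V' `&` half_space R n) (val (val y)).
  split; last exact: set_valP.
  exact/VV'/set_valP.
exists U, V', c, d; split => //.
  suff Uprop (y : U) : [/\ (V' `&` half_space R n) (c (val y)),
      d (c (val y)) = val y & {for val y, continuous c}].
    by move=> y Uy; exact: (Uprop (exist _ y (mem_set Uy))).
  split; [by rewrite cE|by rewrite cE dE fK|].
  move=> S; rewrite cE => Sy.
  have : nbhs y [set z : U | S (val (val (f z)))].
    apply: (fc y [set z : V | S (val (val z))]); apply/nbhs_set_type.
    exists [set z : half_space R n | S (val z)] => //.
    by apply/nbhs_set_type; exists S.
  case/nbhs_set_type => W Wy WS.
  have UW : nbhs (val y) (U `&` W).
    by apply: filterI => //; apply: open_nbhs_nbhs; split => //; exact: set_valP.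
  apply: filterS UW => z [Uz Wz].
  by have := WS (exist _ z (mem_set Uz)) Wz; rewrite /= -cE.
move=> z /WP[y <-]; rewrite dE; split.
- exact: set_valP.
- by rewrite cE gK.
move=> S Sy.
have : nbhs y [set z : V | S (val (g z))].
  by apply: (gc y [set z : U | S (val z)]); apply/nbhs_set_type; exists S.
case/nbhs_set_type => W /nbhs_set_type[W' W'y W'W] WS.
rewrite /= /within /nbhs/=; apply: filterS W'y => z' W'z' /WP[y' y'E].
by rewrite -y'E dE; apply: WS; apply: W'W; rewrite y'E.
Qed.

End Charts.

Section Boxes.
Variable (R : realType).

Lemma coord_continuous_comp m (Y : topologicalType) (c : Y -> 'rV[R]_m) y i :
  {for y, continuous c} -> {for y, continuous (fun y => c y ord0 i)}.
Proof.
move=> cy; pose coord (z : 'rV[R]_m) := z ord0 i.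
have := @continuous_comp _ _ _ c coord y cy.
by move/(_ (@coord_continuous R 1 m ord0 i (c y))).
Qed.

(** A closed ball of small radius. *)
Lemma metrizable_closed_nbhs (Y : topologicalType) (p q : Y) (U : set Y) :
    metrizable R Y -> open U -> U p -> p <> q ->
  exists W, [/\ closed W, nbhs p W, W `<=` U & ~ W q].
Proof.
case=> d [d0 dC dD dnbhs] Uo Up pq.
have dxx x : d x x = 0 by apply/d0.
have d_ge0 x y : 0 <= d x y.
  by have := dD x y x; rewrite dxx dC (dC y x); lra.
have dpq : 0 < d p q.
  by rewrite lt_neqAle d_ge0 andbT; apply/eqP => /esym /d0.
have /dnbhs[e e0 eU] : nbhs p U by exact: open_nbhs_nbhs.
pose r := Num.min (e / 2) (d p q / 2).
have r0 : 0 < r by rewrite lt_min !divr_gt0.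
have re : r < e by rewrite /r gt_min; apply/orP; left; lra.
have rq : r < d p q by rewrite /r gt_min; apply/orP; right; lra.
exists [set y | d p y <= r]; split.
- rewrite -[X in closed X]setCK; apply: open_closedC; rewrite openE => y /= pyr.
  apply/dnbhs; exists (d p y - r); first by rewrite subr_gt0 ltNge; apply/negP.
  by move=> z /= yz pz; have := dD p z y; rewrite (dC z y); lra.
- by apply/dnbhs; exists r => // y /= /ltW.
- by move=> y /= pyr; apply: eU; exact: le_lt_trans re.
- by rewrite /= leNgt rq.
Qed.

(** The sets [O] and [Cl] are the open and the closed box of half-width [e / 2] about
[p] in a chart.  To see that [Cl] is closed in [Y], and not only in the chart
domain, it is cut out of a closed neighbourhood [W] of [p] contained in that
domain; a small box lies in [W] by continuity of the inverse of the chart. *)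
Lemma box_nbhs m (Y : topologicalType) (p q : Y) :
    manifold R m Y -> p <> q ->
  exists (U : set Y) (c : Y -> 'rV[R]_m) (O Cl : set Y) (F : 'I_m -> seq R),
    [/\ open U, {in U, continuous c} & {in U &, injective c}] /\
    [/\ open O, closed Cl, O p /\ ~ Cl q, O `<=` Cl /\ Cl `<=` U &
      forall y, Cl y -> ~ O y -> exists i, c y ord0 i \in F i].
Proof.
move=> Ym pq; have [U [V [c [d [Uo Up cP Vo dP]]]]] := manifold_chart p Ym.
have [W [Wcl Wp WU nWq]] := metrizable_closed_nbhs Ym.1 Uo Up pq.
have [cp dcp _] := cP p Up.
have [_ _ /(_ W)] := dP _ cp; rewrite dcp => /(_ Wp) /= Wd.
have {Wd} : nbhs (c p) [set z | (V `&` half_space R m) z -> W (d z)] by [].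
move=> /nbhs_ballP[e /= e0 eW].
pose O := [set y | U y /\ forall i, `|c p ord0 i - c y ord0 i| < e / 2].
pose Cl := [set y | W y /\ forall i, `|c p ord0 i - c y ord0 i| <= e / 2].
have cc y i : U y -> {for y, continuous (fun y => `|c p ord0 i - c y ord0 i|)}.
  move=> Uy; have [_ _ cy] := cP y Uy.
  apply: cvg_norm; apply: cvgB; first exact: cvg_cst.
  exact: coord_continuous_comp.
exists U, c, O, Cl, (fun i => [:: c p ord0 i - e / 2; c p ord0 i + e / 2]).
split; first split => //.
- by move=> y; rewrite inE => /cP[].
- move=> y y'; rewrite !inE => /cP[_ yE _] /cP[_ y'E _] E.
  by rewrite -yE -y'E E.
split.
- rewrite openE => y [Uy yO].
  rewrite /interior; near=> z; split; first by near: z; exact: open_nbhs_nbhs.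
  near: z; apply: filter_forall => i.
  exact: (cc y i Uy) (lt_nbhsl (yO i)).
- rewrite -[X in closed X]setCK; apply: open_closedC; rewrite openE => y /= nCly.
  have [Wy|nWy] := pselect (W y); last first.
    have : nbhs y (~` W) by apply: open_nbhs_nbhs; split => //; exact: closed_openC.
    by apply: filterS => z nWz [].
  have [i yi] : exists i, e / 2 < `|c p ord0 i - c y ord0 i|.
    apply: contrapT => /forallNP nyi; apply: nCly; split => // i.
    by rewrite leNgt; apply/negP; exact: nyi.
  have : nbhs y [set z | e / 2 < `|c p ord0 i - c z ord0 i|].
    exact: (cc y i (WU y Wy)) (lt_nbhsr yi).
  by apply: filterS => z /= zi [_ /(_ i)]; rewrite leNgt zi.
- split; last by case.
  by split => // i; rewrite subrr normr0 divr_gt0.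
- split; last by move=> y [/WU].
  move=> y [Uy yO]; split; last by move=> i; exact: ltW.
  have [cy <- _] := cP y Uy; apply: eW => //; split => // j i.
  rewrite (ord1 j) /ball /=; apply: lt_le_trans (yO i) _; lra.
- move=> y [Wy yCl] nOy.
  have [i yi] : exists i, e / 2 <= `|c p ord0 i - c y ord0 i|.
    apply: contrapT => /forallNP nyi; apply: nOy; split; first exact: WU.
    by move=> i; rewrite ltNge; apply/negP; exact: nyi.
  exists i; have := yCl i.
  rewrite !inE; move: yi; rewrite real_ler_normr ?num_real// real_ler_norml ?num_real//.
  move=> /orP yi /andP[y1 y2]; apply/orP.
  by case: yi => yi; [left|right]; apply/eqP; lra.
Unshelve. all: by end_near.
Qed.

Lemma between_avoiding (s : seq R) a b : a < b ->
  exists2 r, a < r < b & r \notin s.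
Proof.
move=> ab; suff [a' [b' [aa' a'b' b'b out]]] : exists a' b',
    [/\ a <= a', a' < b', b' <= b & forall r, a' < r < b' -> r \notin s].
  exists ((a' + b') / 2); first lra.
  by apply: out; lra.
elim: s => [|x s [a' [b' [aa' a'b' b'b out]]]]; first by exists a, b.
have [xm|xm] := leP x ((a' + b') / 2).
  exists ((a' + b') / 2), b'; split; try lra.
  move=> r rb; rewrite inE negb_or out ?andbT; last by lra.
  by apply/eqP => rx; lra.
exists a', ((a' + b') / 2); split; try lra.
move=> r rb; rewrite inE negb_or out ?andbT; last by lra.
by apply/eqP => rx; lra.
Qed.

End Boxes.

(** * The descent of the degree *)

Section NoInjection.
Variables (R : realType) (T : pseudoMetricType R) (B I : set T).
Hypothesis B_closed : closed B.
Variables (Y : topologicalType) (g : T -> Y).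
Hypothesis g_darboux : forall C, C `<=` I -> connected C -> connected (g @` C).
Hypothesis g_inj : {in I &, injective g}.

Lemma two_points k K w : cocycle B k.+1 K w -> ~ cobounds B k.+1 K w ->
  exists x y, [/\ K x, K y & x <> y].
Proof.
move=> wK wNK; have [[x Kx]|K0] := pselect (K !=set0); last first.
  by exfalso; apply: wNK; apply: cobounds_le (cobounds0 _ _ _) => x Kx; case: K0; exists x.
apply: contrapT => /forallNP/(_ x)/forallNP Kxy; apply: wNK.
apply: (@cobounds_sub1 _ _ _ _ _ _ x) wK => y Ky.
by apply: contrapT => xy; apply: (Kxy y); split => // yx; exact: xy.
Qed.

(** Induction on the degree [k].  The number of coordinates confined to finite sets is
more than [m - k]; each step separates two image points by a hyperplane
[c_i = r] with [r] outside [F i], and so confines one coordinate more.  In degree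
[0] all coordinates would be confined and one more, hence [K] is empty. *)
Lemma no_carrier_in_chart m (U : set Y) (c : Y -> 'rV[R]_m) k (F : 'I_m -> seq R)
    (K : set T) (w : seq T -> bool) :
    open U -> {in U, continuous c} -> {in U &, injective c} ->
    compact K -> closed K -> K `<=` I -> cocycle B k K w -> ~ cobounds B k K w ->
    (forall x, K x -> U (g x) /\
      (m < k + #|[pred i | c (g x) ord0 i \in F i]|)%N) -> False.
Proof.
move=> Uo cc ci; elim: k F K w => [|k IH] F K w cK Kcl KI wK wNK KF.
  apply: wNK; apply: cobounds_le (cobounds0 _ _ _) => x /KF[_].
  by rewrite add0n ltnNge (leq_trans (max_card _)) ?card_ord.
have [K0 [K0K K0cl wNK0 wmin]] := minimal_carrier B_closed cK Kcl wK wNK.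
have cK0 : compact K0 by exact: subclosed_compact cK K0K.
have wK0 := cocycle_le K0K wK.
have UK0 x : K0 x -> U (g x) by move=> /K0K/KF[].
have [x1 [x2 [K1 K2 [i lt12]]]] : exists x1 x2, [/\ K0 x1, K0 x2 &
    exists i, c (g x1) ord0 i < c (g x2) ord0 i].
  have [x [y [Kx Ky xy]]] := two_points wK0 wNK0.
  have [i ni] : exists i, c (g x) ord0 i <> c (g y) ord0 i.
    apply: contrapT => /forallNP cxy; apply: xy.
    apply: g_inj; rewrite ?inE; [exact/KI/K0K|exact/KI/K0K|].
    apply: ci; rewrite ?inE; [exact: UK0|exact: UK0|].
    by apply/rowP => i; apply: contrapT; exact: cxy.
  case: (ltgtP (c (g x) ord0 i) (c (g y) ord0 i)) => // [lt|lt].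
    by exists x, y; split => //; exists i.
  by exists y, x; split => //; exists i.
have [r /andP[r1 r2] rF] := between_avoiding (F i) lt12.
pose co y := c y ord0 i.
have coc y : U y -> {for y, continuous co}.
  by move=> Uy; apply: coord_continuous_comp; apply: cc; rewrite inE.
have O1o : open (U `&` co @^-1` [set z | z < r]).
  rewrite openE => y [Uy yr]; apply: filterI; first exact: open_nbhs_nbhs.
  exact: (coc y Uy) (lt_nbhsl yr).
have O2o : open (U `&` co @^-1` [set z | r < z]).
  rewrite openE => y [Uy yr]; apply: filterI; first exact: open_nbhs_nbhs.
  exact: (coc y Uy) (lt_nbhsr yr).
have gD C : C `<=` K0 -> connected C -> connected (g @` C).
  by move=> CK0; apply: g_darboux => z /CK0/K0K/KI.
have [|||L [u [Lcl LK uL uNL]]] := darboux_carrier B_closed cK0 K0cl wK0 wNK0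
    wmin gD O1o O2o.
- rewrite -subset0 => y [[_ /= y1] [_ /= y2]].
  by have := lt_trans y1 y2; rewrite ltxx.
- by exists x1 => //; split => //; exact: UK0.
- by exists x2 => //; split => //; exact: UK0.
have LK' : L `<=` K by move=> x /LK[/K0K].
apply: (IH (fun j => if j == i then r :: F i else F j) L u) => //.
- exact: subclosed_compact cK LK'.
- by move=> x /LK'/KI.
move=> x Lx; have [K0x nO] := LK x Lx; split; first exact: UK0.
have cr : co (g x) = r.
  apply: contrapT => /eqP; rewrite neq_lt => /orP cr; apply: nO.
  by case: cr => cr; [left|right]; split => //; exact: UK0.
have [_] := KF x (K0K x K0x).
rewrite addSnnS => /leq_trans; apply; rewrite leq_add2l.
have iF : i \notin [pred j | c (g x) ord0 j \in F j].
  by rewrite inE -/(co _) cr.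
have := cardU1 i [pred j | c (g x) ord0 j \in F j]; rewrite iF add1n => <-.
apply: subset_leq_card; apply/fintype.subsetP => j; rewrite !inE.
by case: eqP => [->|_] //=; rewrite -/(co _) cr inE eqxx.
Qed.

(** The two image points separated first may lie in no common chart; the boundary of a
box around one of them separates them and brings the carrier into one chart. *)
Lemma no_carrier m K w : manifold R m Y ->
    compact K -> closed K -> K `<=` I ->
  cocycle B m.+1 K w -> ~ cobounds B m.+1 K w -> False.
Proof.
move=> Ym cK Kcl KI wK wNK.
have [K0 [K0K K0cl wNK0 wmin]] := minimal_carrier B_closed cK Kcl wK wNK.
have cK0 : compact K0 by exact: subclosed_compact cK K0K.
have wK0 := cocycle_le K0K wK.
have [x [y [K0x K0y xy]]] := two_points wK0 wNK0.
have gxy : g x <> g y.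
  by move=> /g_inj; rewrite !inE => /(_ (KI _ (K0K _ K0x)) (KI _ (K0K _ K0y))).
have [U [c [W [Cl [F [[Uo cc ci] [Wo Clcl [Wx nCly] [WCl ClU] ClF]]]]]]] :=
  box_nbhs Ym gxy.
have gD C : C `<=` K0 -> connected C -> connected (g @` C).
  by move=> CK0; apply: g_darboux => z /CK0/K0K/KI.
have [|||L [u [Lcl LK uL uNL]]] := darboux_carrier B_closed cK0 K0cl wK0 wNK0
    wmin gD Wo (closed_openC Clcl).
- by rewrite -subset0 => z [/WCl].
- by exists x.
- by exists y.
have LK' : L `<=` K by move=> z /LK[/K0K].
apply: (no_carrier_in_chart (F := F) Uo cc ci _ Lcl _ uL uNL).
- exact: subclosed_compact cK LK'.
- by move=> z /LK'/KI.
move=> z /LK[_ /not_orP[nWz /contrapT Clz]]; split; first exact: ClU.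
have [i iF] := ClF _ Clz nWz.
by rewrite -[X in (X < _)%N]addn0 ltn_add2l; apply/card_gt0P; exists i; rewrite inE.
Qed.

End NoInjection.

(** * Cubes in manifolds and the comparison of dimensions *)

(** The cube is scaled down and translated so that its corner at the origin goes to
the given point of the chart.  All coordinates are only increased, hence the image
stays in the half-space. *)
Lemma cube_embeds (R : realType) k n (X : topologicalType) (x : X) :
    manifold R n X -> (k < n)%N ->
  exists h : 'rV[R]_k.+1 -> X,
    (forall C, C `<=` @cube R k -> connected C -> connected (h @` C)) /\
    {in @cube R k &, injective h}.
Proof.
move=> Xn kn; have [U [V [c [d [Uo Ux cP Vo dP]]]]] := manifold_chart x Xn.
have [[cxV cxH] _ _] := cP x Ux.
have /nbhs_ballP[e /= e0 eV] : nbhs (c x) V by exact: open_nbhs_nbhs.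
pose shift (y : 'rV[R]_k.+1) (l : 'I_n) : R :=
  if (l < k.+1)%N then y ord0 (inord l) else 0.
pose aff y : 'rV[R]_n := \row_l (c x ord0 l + e / 2 * shift y l).
have e20 : 0 < e / 2 by rewrite divr_gt0.
have shift01 y l : @cube R k y -> 0 <= shift y l <= 1.
  rewrite /shift => yc; case: ifP => _; last by rewrite lexx ler01.
  by have := yc (inord l); rewrite /= in_itv.
have affW y : @cube R k y -> (V `&` half_space R n) (aff y).
  move=> yc; split; last first.
    move=> l l0; rewrite mxE addr_ge0 ?cxH// mulr_ge0 ?(ltW e20)//.
    by have /andP[] := shift01 y l yc.
  apply: eV; split => // i l; rewrite (ord1 i) mxE /ball /=.
  rewrite opprD addrA subrr sub0r normrN.
  have /andP[s0 s1] := shift01 y l yc.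
  rewrite ger0_norm; last by rewrite mulr_ge0// ltW.
  have : e / 2 * shift y l <= e / 2 by rewrite ler_piMr// ltW.
  lra.
have aff_cont : continuous aff.
  move=> a S /nbhs_ballP[r /= r0 rS].
  have r' : 0 < r / (e / 2) by rewrite divr_gt0.
  have : nbhs a (ball a (r / (e / 2))) by exact: nbhsx_ballx.
  apply: filterS => z [_ yz]; apply: rS; split => // i0 l0.
  rewrite (ord1 i0) !mxE /ball /= opprD addrACA subrr add0r -mulrBr normrM.
  rewrite (ger0_norm (ltW e20)) mulrC -ltr_pdivlMr// /shift.
  case: ifP => _; last by rewrite subrr normr0.
  exact: yz.
exists (d \o aff); split.
  move=> C Ccube Cconn; rewrite -image_comp.
  apply: connected_continuous_connected.
    apply: connected_continuous_connected => //.
    exact: continuous_subspaceT.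
  apply: (@continuous_subspaceW _ _ _ (V `&` half_space R n)).
    by move=> _ [y Cy <-]; apply: affW; exact: Ccube.
  by apply/subspace_continuousP => z zW; have [] := dP z zW.
move=> y y'; rewrite !inE => yc y'c /= E.
have affE : aff y = aff y'.
  have [_ <- _] := dP _ (affW y yc); have [_ <- _] := dP _ (affW y' y'c).
  by rewrite E.
apply/rowP => j; have jn : (j < n)%N by exact: leq_trans (ltn_ord j) kn.
move/rowP/(_ (Ordinal jn)): affE; rewrite !mxE => /addrI /(mulfI (lt0r_neq0 e20)).
by rewrite /shift /= ltn_ord inord_val.
Qed.

Theorem corollary1p6 (R : realType) (X Y : topologicalType) (n m : nat)
    (f : X -> Y)
    (X_nonempty : [set: X] !=set0)
    (X_manifold : manifold R n X) (Y_manifold : manifold R m Y)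
    (f_darboux : darboux f) (f_inj : injective f) :
  (m <= 3)%N -> (n <= m)%N.
Proof.
move=> _; rewrite leqNgt; apply/negP => mn.
have [x _] := X_nonempty.
have [h [h_conn h_inj]] := cube_embeds x X_manifold mn.
apply: (@no_carrier R 'rV[R]_m.+1 (@cube_boundary R m) (@cube R m)
  _ Y (f \o h) _ _ m (@cube R m) (@cube_class R m)) => //.
- exact: closed_cube_boundary.
- by move=> C Ccube /(h_conn _ Ccube)/f_darboux; rewrite image_comp.
- by move=> y y' yc y'c /= /f_inj; exact: h_inj.
- exact: compact_cube.
- exact: closed_cube.
- exact: cocycle_cube_class.
- exact: cube_class_nontrivial.
Qed.
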